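(* Let $\leadsto_X$ be a mechanisable strategy on terms of the linear substitution calculus. Then there is an algorithm that, on input a term $t$ and a natural number $k$, outputs $(\leadsto_X)^{k}(t)$, and which works in time polynomial in $k$ and $|t|$.
   Context: Terms of the linear substitution calculus (LSC) are given by $t,u ::= x \mid \lambda x.t \mid t\,u \mid t[x\leftarrow u]$, where $t[x\leftarrow u]$ is an explicit substitution; reduction consists of ${\tt dB}$-steps ($\beta$ at a distance, creating an explicit substitution) and ${\tt ls}$-steps (linear substitution, replacing one occurrence of $x$ in $t$ by a copy of $u$ in $t[x\leftarrow u]$), closed under shallow contexts (contexts whose hole is not inside an explicit substitution). $|t|$ denotes the size of $t$. For a deterministic strategy $\leadsto_X$, a term $t$ and a natural number $k$, $(\leadsto_X)^{k}(t)$ denotes the term $u$ such that $t \leadsto_X^{k} u$ if $k$ is at most the number of $\leadsto_X$-steps needed to reach the normal form of $t$, and the $\leadsto_X$-normal form of $t$ otherwise. A strategy $\leadsto_X$ on LSC terms is mechanisable if, for every derivation $\rho: t \leadsto_X^{*} u$: (Subterm) the terms duplicated (by ${\tt ls}$-steps) along $\rho$ are subterms of $t$; and (Selection) the search for the next $\leadsto_X$-redex to reduce in $u$ takes time polynomial in $|u|$. *)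

(* Defs.v *)
From Stdlib Require List.
From mathcomp Require Import all_boot all_algebra.

Set Implicit Arguments.
Unset Strict Implicit.
Unset Printing Implicit Defensive.

(** * The linear substitution calculus *)

(* Terms up to alpha, in de Bruijn notation.  [ESub t u] is t[x<-u], which binds
   x (index 0) in [t] only. *)
Inductive term :=
| Var (i : nat)
| Lam (t : term)
| App (t u : term)
| ESub (t u : term).

(* The number of constructors: a variable counts 1 whatever its index. *)
Fixpoint term_size (t : term) : nat :=
  match t with
  | Var _ => 1
  | Lam t => (term_size t).+1
  | App t u | ESub t u => (term_size t + term_size u).+1
  end.

Definition up (rho : nat -> nat) (i : nat) : nat :=
  if i is j.+1 then (rho j).+1 else 0.

Fixpoint rename (rho : nat -> nat) (t : term) : term :=
  match t with
  | Var i => Var (rho i)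
  | Lam t => Lam (rename (up rho) t)
  | App t u => App (rename rho t) (rename rho u)
  | ESub t u => ESub (rename (up rho) t) (rename rho u)
  end.

Definition shift (n : nat) : term -> term := rename (addn n).

Fixpoint fv (i : nat) (t : term) : bool :=
  match t with
  | Var j => i == j
  | Lam t => fv i.+1 t
  | App t u => fv i t || fv i u
  | ESub t u => fv i.+1 t || fv i u
  end.

Inductive ctx :=
| Hole
| CLam (C : ctx)
| CAppL (C : ctx) (t : term)
| CAppR (t : term) (C : ctx)
| CSubL (C : ctx) (t : term)
| CSubR (t : term) (C : ctx).

(* Plugging may capture variables. *)
Fixpoint plug (C : ctx) (s : term) : term :=
  match C with
  | Hole => s
  | CLam C => Lam (plug C s)
  | CAppL C t => App (plug C s) t
  | CAppR t C => App t (plug C s)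
  | CSubL C t => ESub (plug C s) t
  | CSubR t C => ESub t (plug C s)
  end.

(* The number of binders above the hole. *)
Fixpoint depth (C : ctx) : nat :=
  match C with
  | Hole => 0
  | CLam C | CSubL C _ => (depth C).+1
  | CAppL C _ | CAppR _ C | CSubR _ C => depth C
  end.

Fixpoint shallow (C : ctx) : bool :=
  match C with
  | Hole => true
  | CLam C | CAppL C _ | CAppR _ C | CSubL C _ => shallow C
  | CSubR _ _ => false
  end.

(* Lists of explicit substitutions L = [x1<-u1]...[xn<-un], the head of the list
   being the outermost one. *)
Fixpoint plugL (L : seq term) (s : term) : term :=
  if L is u :: L' then ESub (plugL L' s) u else s.

(* A redex occurrence, given by the decomposition of the term it belongs to:
     [RdB E L t u]  in  E<L<\x.t> u>       (dB, beta at a distance),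
     [Rls E C u]    in  E<C<x>[x<-u]>      (ls, linear substitution). *)
Inductive redex :=
| RdB (E : ctx) (L : seq term) (t u : term)
| Rls (E C : ctx) (u : term).

Definition source (r : redex) : term :=
  match r with
  | RdB E L t u => plug E (App (plugL L (Lam t)) u)
  | Rls E C u => plug E (ESub (plug C (Var (depth C))) u)
  end.

(* [u] is shifted when it enters the scope of the binders of [L], respectively
   of [C] and of the explicit substitution itself. *)
Definition target (r : redex) : term :=
  match r with
  | RdB E L t u => plug E (plugL L (ESub t (shift (size L) u)))
  | Rls E C u => plug E (ESub (plug C (shift (depth C).+1 u)) u)
  end.

Definition closing (r : redex) : ctx :=
  match r with RdB E _ _ _ | Rls E _ _ => E end.

Definition redex_of (r : redex) (t : term) : Prop :=
  shallow (closing r) /\ source r = t.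

(** * Strategies *)

(* A (deterministic) strategy selects at most one redex in each term. *)
Record strategy := Strategy {
  select :> term -> option redex;
  selectP : forall t r, select t = Some r -> redex_of r t
}.

(* [derivation X t rs u]: t reduces to u in X, firing the redexes rs in order. *)
Inductive derivation (X : strategy) : term -> seq redex -> term -> Prop :=
| deriv_refl t : derivation X t [::] t
| deriv_step t r rs u :
    X t = Some r -> derivation X (target r) rs u -> derivation X t (r :: rs) u.

Definition onestep (X : strategy) (t : term) : term :=
  if X t is Some r then target r else t.

Definition reduct (X : strategy) (k : nat) (t : term) : term :=
  iter k (onestep X) t.

(* [reduct X k t] is the k-th reduct of t if there is one, and the normal form
   of t otherwise. *)
Lemma reductP (X : strategy) (k : nat) (t : term) :
  exists2 rs, derivation X t rs (reduct X k t) &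
    size rs = k \/ size rs < k /\ X (reduct X k t) = None.
Proof.
rewrite /reduct; elim: k t => [|k IHk] t; first by exists [::]; [constructor|left].
rewrite iterSr /onestep; case Xt: (X t) => [r|].
  have [rs rsP rsk] := IHk (target r); exists (r :: rs).
    exact: deriv_step Xt rsP.
  by case: rsk => [<-|[ltk nf]]; [left | right].
have nfk : iter k (onestep X) t = t.
  by elim: k {IHk} => //= k ->; rewrite /onestep Xt.
exists [::]; last by right; rewrite -/(onestep X) nfk.
by rewrite -/(onestep X) nfk; constructor.
Qed.

(* The copied term, with the number of binders above it. *)
Definition duplicated (r : redex) : option (nat * term) :=
  match r with
  | RdB _ _ _ _ => None
  | Rls E _ u => Some (depth E, u)
  end.

(* [v], which occurs under [m] binders, is a subterm of [t] up to alpha: it is an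
   occurrence [s] in [t], where the variables of [s] that are bound in [t] may be
   renamed injectively to bound variables, while those that are free in [t] stay
   the same.  Under [n] binders, the indices < n are the bound variables, and
   n + i is the free variable i. *)
Definition alpha_subterm (m : nat) (v t : term) : Prop :=
  exists (C : ctx) (s : term) (rho : nat -> nat),
    [/\ plug C s = t,
        rename rho s = v,
        (forall i j, fv i s -> fv j s -> rho i = rho j -> i = j),
        (forall i, fv i s -> i < depth C -> rho i < m) &
        (forall i, fv (depth C + i) s -> rho (depth C + i) = m + i)].

(** * The machine model *)

(* WHILE programs on binary trees (Jones, Computability and Complexity, 1997),
   with unit-cost tree operations.  As trees can be stored with sharing, this time
   is polynomially related to the time of Turing machines. *)
Inductive tree := Leaf | Node (l r : tree).

Inductive expr :=
| EVar (x : nat)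
| ENil
| ECons (e f : expr)
| EHd (e : expr)
| ETl (e : expr).

Inductive cmd :=
| Skip
| Assign (x : nat) (e : expr)
| Seq (c d : cmd)
| If (e : expr) (c d : cmd)
| While (e : expr) (c : cmd).

Definition store := nat -> tree.

Definition upd (s : store) (x : nat) (d : tree) : store :=
  fun y => if y == x then d else s y.

Fixpoint eval (s : store) (e : expr) : tree :=
  match e with
  | EVar x => s x
  | ENil => Leaf
  | ECons e f => Node (eval s e) (eval s f)
  | EHd e => if eval s e is Node l _ then l else Leaf
  | ETl e => if eval s e is Node _ r then r else Leaf
  end.

Fixpoint cost (e : expr) : nat :=
  match e with
  | EVar _ | ENil => 1
  | ECons e f => (cost e + cost f).+1
  | EHd e | ETl e => (cost e).+1
  end.

(* [exec c s n s']: from the store s, c terminates in the store s' in time n. *)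
Inductive exec : cmd -> store -> nat -> store -> Prop :=
| exec_skip s : exec Skip s 1 s
| exec_assign x e s : exec (Assign x e) s (cost e).+1 (upd s x (eval s e))
| exec_seq c d s s' s'' n m :
    exec c s n s' -> exec d s' m s'' -> exec (Seq c d) s (n + m).+1 s''
| exec_if_true e c d s s' n :
    eval s e <> Leaf -> exec c s n s' -> exec (If e c d) s (cost e + n).+1 s'
| exec_if_false e c d s s' n :
    eval s e = Leaf -> exec d s n s' -> exec (If e c d) s (cost e + n).+1 s'
| exec_while_true e c s s' s'' n m :
    eval s e <> Leaf -> exec c s n s' -> exec (While e c) s' m s'' ->
    exec (While e c) s (cost e + n + m).+1 s''
| exec_while_false e c s :
    eval s e = Leaf -> exec (While e c) s (cost e).+1 s.

(* Input and output are in variable 0; the other variables start at [Leaf]. *)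
Definition computes (c : cmd) (input output : tree) (n : nat) : Prop :=
  exists2 s, exec c (upd (fun=> Leaf) 0 input) n s & s 0 = output.

(** * Encodings *)

Definition enc_nat (n : nat) : tree := iter n (Node Leaf) Leaf.

Definition enc_bool (b : bool) : tree := if b then Node Leaf Leaf else Leaf.

Definition enc_seq (A : Type) (enc : A -> tree) (s : seq A) : tree :=
  foldr (fun a d => Node (enc a) d) Leaf s.

Definition enc_option (A : Type) (enc : A -> tree) (o : option A) : tree :=
  if o is Some a then Node Leaf (enc a) else Leaf.

Definition enc_pair (A B : Type) (encA : A -> tree) (encB : B -> tree)
  (p : A * B) : tree := Node (encA p.1) (encB p.2).

Fixpoint enc_term (t : term) : tree :=
  match t with
  | Var i => Node (enc_nat 0) (enc_nat i)
  | Lam t => Node (enc_nat 1) (enc_term t)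
  | App t u => Node (enc_nat 2) (Node (enc_term t) (enc_term u))
  | ESub t u => Node (enc_nat 3) (Node (enc_term t) (enc_term u))
  end.

(* The path from the root to the hole: [true] for the second subterm of an
   application or of an explicit substitution, [false] otherwise. *)
Fixpoint path_of (C : ctx) : seq bool :=
  match C with
  | Hole => [::]
  | CLam C | CAppL C _ | CSubL C _ => false :: path_of C
  | CAppR _ C | CSubR _ C => true :: path_of C
  end.

(* A redex is located by the path to its root (an application for dB, an explicit
   substitution for ls) and, for ls, by the path from the body of the explicit
   substitution to the variable occurrence to be replaced. *)
Definition position (r : redex) : seq bool * option (seq bool) :=
  match r with
  | RdB E _ _ _ => (path_of E, None)
  | Rls E C _ => (path_of E, Some (path_of C))
  end.

Definition enc_position : seq bool * option (seq bool) -> tree :=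
  enc_pair (enc_seq enc_bool) (enc_option (enc_seq enc_bool)).

(** * Mechanisable strategies *)

Definition subterm_property (X : strategy) : Prop :=
  forall t rs u, derivation X t rs u ->
  forall r m v, List.In r rs -> duplicated r = Some (m, v) ->
  alpha_subterm m v t.

(* The search either finds the position of the next redex, or reports that there
   is none. *)
Definition selection_property (X : strategy) : Prop :=
  exists (c : cmd) (p : {poly nat}),
  forall t rs u, derivation X t rs u ->
  exists2 n,
    computes c (enc_term u) (enc_option enc_position (omap position (X u))) n &
    n <= p.[term_size u]%R.

Definition mechanisable (X : strategy) : Prop :=
  subterm_property X /\ selection_property X.

(* Main.v *)
Require Import Defs.
From Stdlib Require Import FunctionalExtensionality.
From mathcomp Require Import all_boot all_algebra zify.

Set Implicit Arguments.
Unset Strict Implicit.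
Unset Printing Implicit Defensive.

(* By the subterm property every ls-step copies a term of size at most |t|, and
   dB-steps do not increase the size, so the i-th reduct of t has size at most
   (i + 1) |t|.  The algorithm iterates k times: search the next redex, then fire
   it.  Firing moves a zipper along the position of the redex, shifts one term
   with an explicit stack of tasks, and rebuilds the term from the zipper.  It
   takes time quadratic in the size of the term whatever the de Bruijn indices,
   which may be huge: shifting a variable by n under a cutoff c takes only c steps
   to compare and n steps to add. *)

(** * Timed execution of straight-line code and loops *)

(** Only upper bounds are tracked: the exact time depends on the branches taken, and constants may
    be rounded up freely. *)
Definition execb (c : cmd) (s : store) (b : nat) (s' : store) : Prop :=
  exists2 n, exec c s n s' & n <= b.

Lemma execb_le c s b b' s' : execb c s b s' -> b <= b' -> execb c s b' s'.
Proof. by case=> n cs nb bb'; exists n => //; exact: leq_trans bb'. Qed.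

Lemma execb_seq c d s s' s'' a b :
  execb c s a s' -> execb d s' b s'' -> execb (Seq c d) s (a + b).+1 s''.
Proof.
move=> [n cs na] [m ds mb]; exists (n + m).+1; first exact: exec_seq cs ds.
by rewrite ltnS leq_add.
Qed.

Lemma execb_assign x e s : execb (Assign x e) s (cost e).+1 (upd s x (eval s e)).
Proof. by exists (cost e).+1 => //; exact: exec_assign. Qed.

Lemma execb_if_true e c d s s' a :
  eval s e <> Leaf -> execb c s a s' -> execb (If e c d) s (cost e + a).+1 s'.
Proof.
move=> g [n cn na]; exists (cost e + n).+1; first exact: exec_if_true.
by rewrite ltnS leq_add2l.
Qed.

Lemma execb_if_false e c d s s' a :
  eval s e = Leaf -> execb d s a s' -> execb (If e c d) s (cost e + a).+1 s'.
Proof.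
move=> g [n cn na]; exists (cost e + n).+1; first exact: exec_if_false.
by rewrite ltnS leq_add2l.
Qed.

(** On an explicit list of registers straight-line code runs by computation; the abstract rest [r]
    hides what the selection program leaves behind. *)
Definition store_of (l : seq tree) (r : store) : store :=
  fun x => if x < size l then nth Leaf l x else r x.

(* Loops are skipped: the result is meaningful for [straight] commands only. *)
Fixpoint lrun (c : cmd) (l : seq tree) : seq tree :=
  match c with
  | Skip | While _ _ => l
  | Assign x e => set_nth Leaf l x (eval (nth Leaf l) e)
  | Seq c d => lrun d (lrun c l)
  | If e c d => if eval (nth Leaf l) e is Node _ _ then lrun c l else lrun d l
  end.

Fixpoint expr_below (n : nat) (e : expr) : bool :=
  match e with
  | EVar x => x < n
  | ENil => true
  | ECons e f => expr_below n e && expr_below n f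
  | EHd e | ETl e => expr_below n e
  end.

Fixpoint straight (n : nat) (c : cmd) : bool :=
  match c with
  | Skip => true
  | Assign x e => (x < n) && expr_below n e
  | Seq c d => straight n c && straight n d
  | If e c d => [&& expr_below n e, straight n c & straight n d]
  | While _ _ => false
  end.

Fixpoint time_bound (c : cmd) : nat :=
  match c with
  | Skip | While _ _ => 1
  | Assign _ e => (cost e).+1
  | Seq c d => (time_bound c + time_bound d).+1
  | If e c d => (cost e + maxn (time_bound c) (time_bound d)).+1
  end.

Lemma eval_store_of e l r :
  expr_below (size l) e -> eval (store_of l r) e = eval (nth Leaf l) e.
Proof.
elim: e => //= [x|e IHe f IHf|e IHe|e IHe]; first by rewrite /store_of => ->.
- by case/andP=> /IHe -> /IHf ->.
- by move/IHe ->.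
- by move/IHe ->.
Qed.

Lemma upd_store_of l r x d :
  x < size l -> upd (store_of l r) x d = store_of (set_nth Leaf l x d) r.
Proof.
move=> lx; apply: functional_extensionality => y.
rewrite /upd /store_of size_set_nth nth_set_nth /= (maxn_idPr lx).
by case: eqP => [->|//]; rewrite lx.
Qed.

Lemma size_lrun c l : straight (size l) c -> size (lrun c l) = size l.
Proof.
elim: c l => //= [x e|c IHc d IHd|e c IHc d IHd] l.
- by case/andP=> lx _; rewrite size_set_nth (maxn_idPr lx).
- by case/andP=> /IHc sc; rewrite -{1}sc => /IHd ->.
- by case/and3P=> _ /IHc sc /IHd sd; case: (eval _ _).
Qed.

Lemma execb_straight c l r : straight (size l) c ->
  execb c (store_of l r) (time_bound c) (store_of (lrun c l) r).
Proof.
elim: c l => //= [|x e|c IHc d IHd|e c IHc d IHd] l.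
- by move=> _; exists 1 => //; constructor.
- case/andP=> lx le; rewrite -upd_store_of // -(eval_store_of r) //.
  exact: execb_assign.
- case/andP=> sc; have {1}<- := size_lrun sc => sd.
  exact: execb_seq (IHc _ sc) (IHd _ sd).
- case/and3P=> le /IHc cc /IHd dd; rewrite -(eval_store_of r) //.
  case v: (eval _ _) => [|? ?].
    by apply: execb_le (execb_if_false _ v dd) _; rewrite ltnS leq_add2l leq_maxr.
  have ne : eval (store_of l r) e <> Leaf by rewrite v.
  by apply: execb_le (execb_if_true _ ne cc) _; rewrite ltnS leq_add2l leq_maxl.
Qed.

(* The states reached at the head of a loop with a straight-line body, after a
   given number of iterations. *)
Inductive loops (e : expr) (c : cmd) : nat -> seq tree -> seq tree -> Prop :=
| loops0 l : loops e c 0 l l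
| loopsS m l l' : eval (nth Leaf l) e <> Leaf -> loops e c m (lrun c l) l' ->
    loops e c m.+1 l l'.

Lemma loops_trans e c m m' l l' l'' :
  loops e c m l l' -> loops e c m' l' l'' -> loops e c (m + m') l l''.
Proof. by elim=> // {l l'} {}m l l' g _ IH /IH; rewrite addSn; exact: loopsS. Qed.

(** Strictness of the last inequality pays the unit cost of the loop itself; [m.+1] counts the
    final, failing test. *)
Lemma execb_while b e c m l l' r :
  loops e c m l l' -> eval (nth Leaf l') e = Leaf ->
  expr_below (size l) e -> straight (size l) c -> cost e + time_bound c < b ->
  execb (While e c) (store_of l r) (m.+1 * b) (store_of l' r).
Proof.
move=> + + + + hb; elim=> {l l'} [l g be sc|{}m l l' g _ IH g' be sc].
  exists (cost e).+1; last by nia.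
  by apply: exec_while_false; rewrite eval_store_of.
have [n cn nb] := execb_straight r sc.
have [] := IH g'; rewrite ?size_lrun // => n' cn' nb'.
exists (cost e + n + n').+1; last by nia.
by apply: exec_while_true cn cn'; rewrite eval_store_of.
Qed.

(** * Running a program on renamed variables *)

Fixpoint expr_shift (o : nat) (e : expr) : expr :=
  match e with
  | EVar x => EVar (o + x)
  | ENil => ENil
  | ECons e f => ECons (expr_shift o e) (expr_shift o f)
  | EHd e => EHd (expr_shift o e)
  | ETl e => ETl (expr_shift o e)
  end.

Fixpoint cmd_shift (o : nat) (c : cmd) : cmd :=
  match c with
  | Skip => Skip
  | Assign x e => Assign (o + x) (expr_shift o e)
  | Seq c d => Seq (cmd_shift o c) (cmd_shift o d)
  | If e c d => If (expr_shift o e) (cmd_shift o c) (cmd_shift o d)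
  | While e c => While (expr_shift o e) (cmd_shift o c)
  end.

Fixpoint expr_bound (e : expr) : nat :=
  match e with
  | EVar x => x.+1
  | ENil => 0
  | ECons e f => maxn (expr_bound e) (expr_bound f)
  | EHd e | ETl e => expr_bound e
  end.

Fixpoint cmd_bound (c : cmd) : nat :=
  match c with
  | Skip => 0
  | Assign x e => maxn x.+1 (expr_bound e)
  | Seq c d => maxn (cmd_bound c) (cmd_bound d)
  | If e c d => maxn (expr_bound e) (maxn (cmd_bound c) (cmd_bound d))
  | While e c => maxn (expr_bound e) (cmd_bound c)
  end.

Lemma cost_shift o e : cost (expr_shift o e) = cost e.
Proof. by elim: e => //= [e -> f ->|e ->|e ->]. Qed.

Definition agree (o N : nat) (s r : store) : Prop :=
  forall x, x < N -> r (o + x) = s x.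

Lemma eval_shift o N s r e : agree o N s r -> expr_bound e <= N ->
  eval r (expr_shift o e) = eval s e.
Proof.
move=> sr; elim: e => /= [x||e IHe f IHf|e IHe|e IHe] //; first exact: sr.
- by rewrite geq_max => /andP[/IHe -> /IHf ->].
- by move/IHe ->.
- by move/IHe ->.
Qed.

(** The selection program is arbitrary, so it is moved above the registers of the machine. The
    induction is on the execution, which makes loops go through. *)
Lemma exec_shift o N c s n s' : exec c s n s' -> cmd_bound c <= N ->
  forall r, agree o N s r ->
  exists r', [/\ exec (cmd_shift o c) r n r', agree o N s' r' &
    forall y, y < o -> r' y = r y].
Proof.
elim=> {c s n s'} /=.
- by move=> s _ r sr; exists r; split=> //; constructor.
- move=> x e s; rewrite geq_max => /andP[xN eN] r sr.
  exists (upd r (o + x) (eval s e)); split.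
  + by rewrite -(eval_shift sr eN) -(cost_shift o e); constructor.
  + by move=> y yN; rewrite /upd eqn_add2l sr.
  + by move=> y yo; rewrite /upd; case: eqP => // ?; lia.
- move=> c d s s' s'' n m _ IHc _ IHd; rewrite geq_max => /andP[cN dN] r sr.
  have [r1 [c1 a1 f1]] := IHc cN r sr.
  have [r2 [c2 a2 f2]] := IHd dN r1 a1.
  exists r2; split=> //; first exact: exec_seq c1 c2.
  by move=> y yo; rewrite f2 // f1.
- move=> e c d s s' n g _ IH; rewrite !geq_max => /and3P[eN cN dN] r sr.
  have [r1 [c1 a1 f1]] := IH cN r sr; exists r1; split=> //.
  by rewrite -(cost_shift o e); apply: exec_if_true c1; rewrite (eval_shift sr).
- move=> e c d s s' n g _ IH; rewrite !geq_max => /and3P[eN cN dN] r sr.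
  have [r1 [c1 a1 f1]] := IH dN r sr; exists r1; split=> //.
  by rewrite -(cost_shift o e); apply: exec_if_false c1; rewrite (eval_shift sr).
- move=> e c s s' s'' n m g _ IHc _ IHw; rewrite geq_max => /andP[eN cN] r sr.
  have [r1 [c1 a1 f1]] := IHc cN r sr.
  have [|r2 [c2 a2 f2]] := IHw _ r1 a1; first by rewrite geq_max eN.
  exists r2; split=> //; last by move=> y yo; rewrite f2 // f1.
  by rewrite -(cost_shift o e); apply: exec_while_true c1 c2; rewrite (eval_shift sr).
- move=> e c s g; rewrite geq_max => /andP[eN cN] r sr.
  exists r; split=> //.
  by rewrite -(cost_shift o e); apply: exec_while_false; rewrite (eval_shift sr).
Qed.

(** [computes] starts from empty variables, whereas each new search finds the leftovers of the
    previous one. *)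
Fixpoint clear (o n : nat) : cmd :=
  if n is m.+1 then Seq (clear o m) (Assign (o + m) ENil) else Skip.

Lemma execb_clear o n s : exists s', [/\ execb (clear o n) s (4 * n).+1 s',
  agree o n (fun=> Leaf) s' & forall y, y < o -> s' y = s y].
Proof.
elim: n => [|n [s' [c1 a1 f1]]] /=.
  by exists s; split=> //; exists 1 => //; constructor.
exists (upd s' (o + n) Leaf); split.
- by apply: execb_le (execb_seq c1 (execb_assign _ ENil _)) _ => /=; lia.
- move=> x; rewrite ltnS leq_eqVlt /upd eqn_add2l.
  by case: eqP => //= _; exact: a1.
- by move=> y yo; rewrite /upd; case: eqP => [?|_]; [lia|exact: f1].
Qed.

(** Variable 0 of [c], its input and output, becomes [o]. The [.+1] keeps it in the cleared window
    even if [c] mentions no variable. *)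
Definition call (o : nat) (c : cmd) (x y : nat) : cmd :=
  Seq (clear o (cmd_bound c).+1)
    (Seq (Assign o (EVar x)) (Seq (cmd_shift o c) (Assign y (EVar o)))).

Lemma execb_call c x y l r a b n : computes c a b n ->
  x < size l -> y < size l -> nth Leaf l x = a ->
  exists r', execb (call (size l) c x y) (store_of l r)
    (n + 4 * cmd_bound c + 20) (store_of (set_nth Leaf l y b) r').
Proof.
case=> s' cs s'0 lx ly lxa; set o := size l; set N := (cmd_bound c).+1.
have [s1 [c1 a1 f1]] := execb_clear o N (store_of l r).
set s2 := upd s1 o a.
have c2 : execb (Assign o (EVar x)) s1 2 s2.
  rewrite /s2; have -> : a = eval s1 (EVar x).
    by rewrite /= f1 // /store_of lx lxa.
  exact: execb_assign.
have a2 : agree o N (upd (fun=> Leaf) 0 a) s2.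
  move=> z zN; rewrite /s2 /upd -{2}[o]addn0 eqn_add2l.
  by case: eqP => // _; exact: a1.
have [s3 [c3 a3 f3]] := exec_shift cs (leqnSn _) a2.
exists s3.
have -> : store_of (set_nth Leaf l y b) s3 = upd s3 y (eval s3 (EVar o)).
  apply: functional_extensionality => z.
  have -> : eval s3 (EVar o) = b.
    by rewrite /= -[o]addn0 a3.
  rewrite /upd /store_of size_set_nth nth_set_nth /= (maxn_idPr ly).
  case: eqP => [->|_]; first by rewrite ly.
  case: ifP => // zl; rewrite f3 // /s2 /upd.
  case: eqP => [zo|_]; first by move: zl; rewrite zo ltnn.
  by rewrite f1 // /store_of zl.
apply: execb_le.
  apply: execb_seq c1 (execb_seq c2 (execb_seq _ (execb_assign _ _ _))).
  by exists n; [exact: c3|].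
by rewrite /= /N; lia.
Qed.

(** * Firing a redex *)

(* Registers: current term and remaining steps; path, zipper and number of binders
   crossed; task and result stacks of the shift; path to the variable occurrence;
   scratch. *)
Local Notation rT := 0 (only parsing).
Local Notation rK := 1 (only parsing).
Local Notation rP := 2 (only parsing).
Local Notation rS := 3 (only parsing).
Local Notation rD := 4 (only parsing).
Local Notation rW := 5 (only parsing).
Local Notation rR := 6 (only parsing).
Local Notation rO := 7 (only parsing).
Local Notation rA := 8 (only parsing).

Fixpoint enat (n : nat) : expr := if n is m.+1 then ECons ENil (enat m) else ENil.

Definition push (x : nat) (e : expr) : cmd := Assign x (ECons e (EVar x)).

Definition pop (x : nat) : cmd := Assign x (ETl (EVar x)).

(** Tags are unary: a nonempty [ETl (EHd (EVar rT))] means an application or an explicit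
    substitution, and one more tail singles out the latter. [rD] grows exactly when a binder is
    crossed. *)
Definition descend_body : cmd :=
  Seq (push rS (ECons (EVar rT) (EHd (EVar rP))))
  (Seq (If (EHd (EVar rP))
         (Assign rT (ETl (ETl (EVar rT))))
         (If (ETl (EHd (EVar rT)))
           (Seq (If (ETl (ETl (EHd (EVar rT)))) (push rD ENil) Skip)
                (Assign rT (EHd (ETl (EVar rT)))))
           (Seq (push rD ENil) (pop rT))))
       (pop rP)).

Definition descend : cmd := While (EVar rP) descend_body.

Definition unwrap_body : cmd :=
  Seq (push rS (ECons (EVar rT) ENil))
  (Seq (push rD ENil) (Assign rT (EHd (ETl (EVar rT))))).

(** The position of a dB-redex does not give the length of [L]. On this spine a tag of at least 2
    can only be an explicit substitution, so the loop stops at the abstraction. *)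
Definition unwrap : cmd := While (ETl (EHd (EVar rT))) unwrap_body.

Definition rebuild_body : cmd :=
  Seq (Assign rA (EHd (EHd (EVar rS))))
  (Seq (If (ETl (EHd (EVar rS)))
         (Assign rT (ECons (EHd (EVar rA)) (ECons (EHd (ETl (EVar rA))) (EVar rT))))
         (If (ETl (EHd (EVar rA)))
           (Assign rT (ECons (EHd (EVar rA)) (ECons (EVar rT) (ETl (ETl (EVar rA))))))
           (Assign rT (ECons (EHd (EVar rA)) (EVar rT)))))
       (pop rS)).

Definition rebuild : cmd := While (EVar rS) rebuild_body.

(* Tasks on the stack rW of the shifting loop:
   0, (c, t)       push on rR the term t with its variables >= c shifted by rD;
   1, tag          build a term with this tag from the top of rR;
   2, (c, (j, i))  push the shift of Var i, where c and j are the rests of a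
                   cutoff and of i that are still to be compared;
   3, (n, i)       push Var (n + i). *)
Definition task (kind : nat) (e : expr) : expr := ECons (enat kind) e.

(** The task pushed last runs first: the left subterm is done before the right one, and task 1 finds
    the right result on top of [rR]. Successive tails of the unary kind separate the four tasks. *)
Definition shift_body : cmd :=
  let A := EVar rA in let B := ETl A in
  let tag := EHd (ETl B) in let arg := ETl (ETl B) in
  Seq (Assign rA (EHd (EVar rW)))
  (Seq (pop rW)
  (If (EHd A)
    (If (ETl (EHd A))
      (If (ETl (ETl (EHd A)))
        (If (EHd B)
          (push rW (task 3 (ECons (ETl (EHd B)) (ECons ENil (ETl B)))))
          (push rR (ECons ENil (ETl B))))
        (If (EHd B)
          (If (EHd (ETl B))
            (push rW (task 2 (ECons (ETl (EHd B))
                                (ECons (ETl (EHd (ETl B))) (ETl (ETl B))))))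
            (push rR (ECons ENil (ETl (ETl B)))))
          (push rW (task 3 (ECons (EVar rD) (ETl (ETl B)))))))
      (If (ETl B)
        (Assign rR (ECons (ECons B (ECons (EHd (ETl (EVar rR))) (EHd (EVar rR))))
                      (ETl (ETl (EVar rR)))))
        (Assign rR (ECons (ECons B (EHd (EVar rR))) (ETl (EVar rR))))))
    (If tag
      (If (ETl tag)
        (Seq (push rW (task 1 tag))
        (Seq (push rW (task 0 (ECons (EHd B) (ETl arg))))
             (If (ETl (ETl tag))
               (push rW (task 0 (ECons (ECons ENil (EHd B)) (EHd arg))))
               (push rW (task 0 (ECons (EHd B) (EHd arg)))))))
        (Seq (push rW (task 1 tag))
             (push rW (task 0 (ECons (ECons ENil (EHd B)) arg)))))
      (push rW (task 2 (ECons (EHd B) (ECons arg arg))))))).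

Definition shift_loop : cmd := While (EVar rW) shift_body.

Definition fire_init : cmd :=
  Seq (Assign rO (ETl (ETl (EVar rP))))
  (Seq (Assign rP (EHd (ETl (EVar rP))))
  (Seq (Assign rS ENil) (Assign rD ENil))).

(** [rD] starts at 1 for the binder of the explicit substitution itself, so the descent ends with
    [(depth C).+1], the shift in [target]. *)
Definition enter_ls : cmd :=
  Seq (push rS (ECons (EVar rT) ENil))
  (Seq (Assign rD (enat 1))
  (Seq (Assign rT (EHd (ETl (EVar rT)))) (Assign rP (ETl (EVar rO))))).

Definition enter_dB : cmd := Seq (Assign rD ENil) (Assign rT (EHd (ETl (EVar rT)))).

Definition shift_init : cmd :=
  Seq (Assign rW (ECons (task 0 (ECons ENil (EVar rW))) ENil)) (Assign rR ENil).

Definition contract : cmd :=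
  If (EVar rO)
    (Assign rT (EHd (EVar rR)))
    (Assign rT (ECons (enat 3) (ECons (EVar rT) (EHd (EVar rR))))).

(** The argument of an application and the content of an explicit substitution sit at the same place
    of the encoding; [rW], idle until the shift, stores either. *)
Definition fire_begin : cmd :=
  Seq fire_init (Seq descend (Assign rW (ETl (ETl (EVar rT))))).

Definition fire_middle : cmd :=
  If (EVar rO)
    (Seq enter_ls descend)
    (Seq enter_dB (Seq unwrap (Assign rT (ETl (EVar rT))))).

Definition fire_end : cmd :=
  Seq shift_init (Seq shift_loop (Seq contract rebuild)).

Definition fire : cmd := Seq fire_begin (Seq fire_middle fire_end).

(* Each frame keeps the whole term that is left behind, so that rebuilding finds
   the tag and the other subterm in it. *)
Fixpoint frames (C : ctx) (s : term) (S : tree) : tree :=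
  let push b C' := frames C' s (Node (Node (enc_term (plug C s)) (enc_bool b)) S) in
  match C with
  | Hole => S
  | CLam C | CAppL C _ | CSubL C _ => push false C
  | CAppR _ C | CSubR _ C => push true C
  end.

(** Seen as a context, [L] can share the frames and the rebuilding loop with ordinary contexts. *)
Fixpoint ctxL (L : seq term) : ctx := if L is u :: L then CSubL (ctxL L) u else Hole.

Lemma plug_ctxL L s : plug (ctxL L) s = plugL L s.
Proof. by elim: L => //= u L ->. Qed.

Lemma depth_ctxL L : depth (ctxL L) = size L.
Proof. by elim: L => //= u L ->. Qed.

Lemma size_path_plug C s :
  size (path_of C) + term_size s <= term_size (plug C s).
Proof. by elim: C => /= [|C IH|C IH t|t C IH|C IH t|t C IH]; lia. Qed.

Lemma depth_path C : depth C <= size (path_of C).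
Proof. by elim: C => //= *; lia. Qed.

(** * Moving down and up along a path *)

Lemma loops_descend C s K S d W R O A :
  loops (EVar rP) descend_body (size (path_of C))
    [:: enc_term (plug C s); K; enc_seq enc_bool (path_of C); S; enc_nat d; W; R; O; A]
    [:: enc_term s; K; Leaf; frames C s S; enc_nat (d + depth C); W; R; O; A].
Proof.
elim: C S d => [|C IH|C IH t|t C IH|C IH t|t C IH] S d /=;
  first by rewrite addn0; constructor.
all: apply: loopsS => //=.
all: by rewrite addnS -addSn; exact: (IH _ d.+1).
Qed.

Lemma loops_unwrap L b K P S d W R O A :
  loops (ETl (EHd (EVar rT))) unwrap_body (size L)
    [:: enc_term (plugL L (Lam b)); K; P; S; enc_nat d; W; R; O; A]
    [:: enc_term (Lam b); K; P; frames (ctxL L) (Lam b) S; enc_nat (d + size L);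
      W; R; O; A].
Proof.
elim: L S d => [|u L IH] S d /=; first by rewrite addn0; constructor.
by apply: loopsS => //=; rewrite plug_ctxL addnS -addSn; exact: (IH _ d.+1).
Qed.

(** [s'] may differ from [s], because a frame is read only for its tag, its direction and its other
    subterm. *)
Lemma loops_rebuild C s s' K P S D W R O A :
  exists A', loops (EVar rS) rebuild_body (size (path_of C))
    [:: enc_term s'; K; P; frames C s S; D; W; R; O; A]
    [:: enc_term (plug C s'); K; P; S; D; W; R; O; A'].
Proof.
elim: C S => [|C IH|C IH t|t C IH|C IH t|t C IH] S /=;
  first by exists A; constructor.
(* The innermost frame is on top of the stack, so the induction hypothesis runs first and the
   outermost frame is popped last. *)
all: set S' := Node _ _; have [A' h] := IH S'.
all: eexists; rewrite -[(size _).+1]addn1; apply: (loops_trans h).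
all: by apply: loopsS => //=; constructor.
Qed.

(** * Correctness and cost of the shifting loop *)

Definition vtask (c : nat) (t : term) : tree :=
  Node (enc_nat 0) (Node (enc_nat c) (enc_term t)).

(** For [rho] equal to [addn n], this is the shift by [n] under [c] binders; the closed form
    exhibits the cutoff test. *)
Lemma iter_up c rho i : iter c up rho i = if i < c then i else c + rho (i - c).
Proof.
elim: c i => [|c IH] [|i] //=; rewrite ?subn0 // IH ltnS subSS.
by case: ifP.
Qed.

Lemma loops_add n i T K P S D W R O A :
  exists A', loops (EVar rW) shift_body n.+1
    [:: T; K; P; S; D; Node (Node (enc_nat 3) (Node (enc_nat n) (enc_nat i))) W; R; O; A]
    [:: T; K; P; S; D; W; Node (enc_term (Var (n + i))) R; O; A'].
Proof.
elim: n i A => [|n IH] i A; first by eexists; apply: loopsS => //=; constructor.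
have [A' h] := IH i.+1 (Node (enc_nat 3) (Node (enc_nat n.+1) (enc_nat i))).
by rewrite addSnnS; exists A'; apply: loopsS.
Qed.

(** [c] and [j] decrease together until one of them is empty, which decides [j < c] in time
    independent of [i]; the addition then takes [n.+1] iterations. *)
Lemma loops_var c j i n T K P S W R O A : j <= i ->
  exists A' m, loops (EVar rW) shift_body m
    [:: T; K; P; S; enc_nat n;
      Node (Node (enc_nat 2) (Node (enc_nat c) (Node (enc_nat j) (enc_nat i)))) W;
      R; O; A]
    [:: T; K; P; S; enc_nat n; W;
      Node (enc_term (Var (if j < c then i else n + i))) R; O; A'] /\ m <= c + n + 2.
Proof.
elim: c j A => [|c IH] [|j] A ji.
- have [A' h] := loops_add n i T K P S (enc_nat n) W R O
    (Node (enc_nat 2) (Node Leaf (Node (enc_nat 0) (enc_nat i)))).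
  by exists A', n.+2; split; [apply: loopsS|lia].
- have [A' h] := loops_add n i T K P S (enc_nat n) W R O
    (Node (enc_nat 2) (Node Leaf (Node (enc_nat j.+1) (enc_nat i)))).
  by exists A', n.+2; split; [apply: loopsS|lia].
- by eexists; exists 1; split; [apply: loopsS => //=; constructor|lia].
have [|A' [m [h hm]]] := IH j
  (Node (enc_nat 2) (Node (enc_nat c.+1) (Node (enc_nat j.+1) (enc_nat i)))).
  exact: ltnW.
by exists A', m.+1; split; [apply: loopsS|lia].
Qed.

(** A variable costs about its cutoff plus [n], and its cutoff exceeds [c] by the binders crossed,
    at most [term_size t]. The other factor counts the nodes. *)
Lemma loops_shift t c n T K P S W R O A :
  exists A' m, loops (EVar rW) shift_body m
    [:: T; K; P; S; enc_nat n; Node (vtask c t) W; R; O; A]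
    [:: T; K; P; S; enc_nat n; W;
      Node (enc_term (rename (iter c up (addn n)) t)) R; O; A'] /\
    m <= term_size t * (c + term_size t + n + 3).
Proof.
elim: t c W R A => [i|t IH|t IHt u IHu|t IHt u IHu] c W R A.
- have [A' [m [h hm]]] := loops_var c n T K P S W R O (vtask c (Var i)) (leqnn i).
  exists A', m.+1; split; last by rewrite /=; lia.
  apply: loopsS => //=; rewrite iter_up.
  have -> : (if i < c then i else c + (n + (i - c))) = if i < c then i else n + i.
    by case: ifP => // ic; lia.
  exact: h.
- have [A' [m [h hm]]] := IH c.+1
    (Node (Node (enc_nat 1) (enc_nat 1)) W) R (vtask c (Lam t)).
  eexists; exists (m + 1).+1; split.
    apply: loopsS => //=; apply: loops_trans h _.
    by apply: loopsS => //=; constructor.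
  by move: hm => /=; nia.
- have [A1 [m1 [h1 hm1]]] := IHt c
    (Node (vtask c u) (Node (Node (enc_nat 1) (enc_nat 2)) W)) R (vtask c (App t u)).
  have [A2 [m2 [h2 hm2]]] := IHu c (Node (Node (enc_nat 1) (enc_nat 2)) W)
    (Node (enc_term (rename (iter c up (addn n)) t)) R) A1.
  eexists; exists (m1 + (m2 + 1)).+1; split.
    apply: loopsS => //=; apply: loops_trans h1 (loops_trans h2 _).
    by apply: loopsS => //=; constructor.
  by move: hm1 hm2 => /=; nia.
- have [A1 [m1 [h1 hm1]]] := IHt c.+1
    (Node (vtask c u) (Node (Node (enc_nat 1) (enc_nat 3)) W)) R (vtask c (ESub t u)).
  have [A2 [m2 [h2 hm2]]] := IHu c (Node (Node (enc_nat 1) (enc_nat 3)) W)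
    (Node (enc_term (rename (iter c.+1 up (addn n)) t)) R) A1.
  eexists; exists (m1 + (m2 + 1)).+1; split.
    apply: loopsS => //=; apply: loops_trans h1 (loops_trans h2 _).
    by apply: loopsS => //=; constructor.
  by move: hm1 hm2 => /=; nia.
Qed.

(** * Assembling the phases of a firing *)

Definition fire_bound (x : nat) : nat := 1000 * (x.+1 * x.+1).

Lemma execb_straight_le b c l l' r : straight (size l) c -> time_bound c <= b ->
  lrun c l = l' -> execb c (store_of l r) b (store_of l' r).
Proof. by move=> sc cb <-; apply: execb_le cb; exact: execb_straight. Qed.

Lemma loops_rebuild2 C1 C2 s1 s2 s K P S D W R O A :
  exists A', loops (EVar rS) rebuild_body (size (path_of C2) + size (path_of C1))
    [:: enc_term s; K; P; frames C2 s2 (frames C1 s1 S); D; W; R; O; A]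
    [:: enc_term (plug C1 (plug C2 s)); K; P; S; D; W; R; O; A'].
Proof.
have [A1 h1] := loops_rebuild C2 s2 s K P (frames C1 s1 S) D W R O A.
have [A2 h2] := loops_rebuild C1 s1 (plug C2 s) K P S D W R O A1.
by exists A2; exact: loops_trans h1 h2.
Qed.

Lemma execb_fire_begin E s t u o K S D W R O A r :
  s = App t u \/ s = ESub t u ->
  execb fire_begin
   (store_of [:: enc_term (plug E s); K; Node Leaf (enc_position (path_of E, o));
     S; D; W; R; O; A] r) (100 * (size (path_of E) + 3))
   (store_of [:: enc_term s; K; Leaf; frames E s Leaf; enc_nat (depth E);
     enc_term u; R; enc_option (enc_seq enc_bool) o; A] r).
Proof.
move=> hs; have h := loops_descend E s K Leaf 0 W R (enc_option (enc_seq enc_bool) o) A.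
apply: execb_le.
  apply: execb_seq.
    by apply: (@execb_straight_le 30).
  apply: execb_seq.
    by apply: (@execb_while 100); [exact: h|..].
  by apply: (@execb_straight_le 10) => //; case: hs => ->.
by lia.
Qed.

(** From the shift on, dB and ls differ only in [contract], whose effect is therefore a hypothesis.
    [C] is the inner stretch of the zipper, below the root of the redex. *)
Lemma execb_fire_end E C s1 s2 s v n T K P R O A r x :
  (forall A, lrun contract [:: T; K; P; frames C s2 (frames E s1 Leaf); enc_nat n;
    Leaf; Node (enc_term (shift n v)) Leaf; O; A] =
    [:: enc_term s; K; P; frames C s2 (frames E s1 Leaf); enc_nat n;
    Leaf; Node (enc_term (shift n v)) Leaf; O; A]) ->
  term_size v <= x -> n <= x -> size (path_of C) + size (path_of E) <= x ->
  exists2 l, size l = 7 &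
  execb fire_end
   (store_of [:: T; K; P; frames C s2 (frames E s1 Leaf); enc_nat n;
     enc_term v; R; O; A] r) (500 * (x.+1 * x.+1))
   (store_of [:: enc_term (plug E (plug C s)), K & l] r).
Proof.
move=> hc vx nx px.
have [A' [m [h hm]]] := loops_shift v 0 n T K P (frames C s2 (frames E s1 Leaf))
  Leaf Leaf O A.
have [A'' h'] := loops_rebuild2 E C s1 s2 s K P Leaf (enc_nat n) Leaf
  (Node (enc_term (shift n v)) Leaf) O A'.
eexists; last first.
  apply: execb_le.
    apply: execb_seq; first by apply: (@execb_straight_le 30).
    apply: execb_seq; first by apply: (@execb_while 100); [exact: h|..].
    apply: execb_seq; first by apply: (@execb_straight_le 30) => //; exact: hc.
    by apply: (@execb_while 100); [exact: h'|..].
  have: m <= x * (x + x + 3) by apply: (leq_trans hm); rewrite leq_mul //; lia.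
  by nia.
by [].
Qed.

Lemma execb_fire r K S D W R O A rest :
  exists2 l, size l = 7 &
  execb fire (store_of [:: enc_term (source r); K;
    Node Leaf (enc_position (position r)); S; D; W; R; O; A] rest)
    (fire_bound (term_size (source r)))
    (store_of [:: enc_term (target r), K & l] rest).
Proof.
case: r => [E L b v|E C v].
  set x := term_size _; set s := App (plugL L (Lam b)) v.
  have hx : size (path_of E) + term_size s <= x := size_path_plug E s.
  have hL := size_path_plug (ctxL L) (Lam b).
  have dL := depth_path (ctxL L); rewrite plug_ctxL depth_ctxL /= in hL dL.
  rewrite /= in hx.
  have h1 := @execb_fire_begin E s _ v None K S D W R O A rest (or_introl erefl).
  have h := loops_unwrap L b K Leaf (frames E s Leaf) 0 (enc_term v) R Leaf A.
  have [||||l sl h3] := @execb_fire_end E (ctxL L) s (Lam b)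
    (ESub b (shift (size L) v)) v (size L) (enc_term b) K Leaf R Leaf A rest x;
    rewrite ?plug_ctxL //; try lia.
  rewrite plug_ctxL in h3.
  exists l => //; apply: execb_le.
    apply: execb_seq h1 _; apply: execb_seq h3.
    apply: execb_if_false => //.
    apply: execb_seq; first by apply: (@execb_straight_le 30).
    apply: execb_seq; first by apply: (@execb_while 100); [exact: h|..].
    by apply: (@execb_straight_le 30).
  rewrite /fire_bound [cost _]/=; nia.
set x := term_size _; set s := ESub (plug C (Var (depth C))) v.
have hx : size (path_of E) + term_size s <= x := size_path_plug E s.
have hC := size_path_plug C (Var (depth C)).
have dC := depth_path C; rewrite /= in hx hC.
pose o := Some (path_of C).
have h1 := @execb_fire_begin E s _ v o K S D W R O A rest (or_intror erefl).
pose Op := enc_option (enc_seq enc_bool) o.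
(* The frame pushed by [enter_ls] is that of [CSubL Hole v]; by conversion the resulting stack is
   the one of [CSubL C v]. *)
have h := loops_descend C (Var (depth C)) K
  (frames (CSubL Hole v) (plug C (Var (depth C))) (frames E s Leaf))
  1 (enc_term v) R Op A.
have [||||l sl h3] := @execb_fire_end E (CSubL C v) s (Var (depth C))
    (shift (depth C).+1 v) v (depth C).+1 (enc_term (Var (depth C))) K Leaf R Op A rest x.
all: rewrite /=; try by []; try lia.
exists l => //; apply: execb_le.
  apply: execb_seq h1 _; apply: execb_seq h3.
  apply: execb_if_true => //.
  apply: execb_seq; first by apply: (@execb_straight_le 30).
  by apply: (@execb_while 100); [exact: h|..].
rewrite /fire_bound [cost _]/=; nia.
Qed.

(** * Size of the reducts *)

Lemma size_rename rho t : term_size (rename rho t) = term_size t.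
Proof.
by elim: t rho => //= [t IH|t IHt u IHu|t IHt u IHu] rho; rewrite ?IH ?IHt ?IHu.
Qed.

Lemma size_plug C s s' :
  term_size (plug C s) + term_size s' = term_size (plug C s') + term_size s.
Proof. by elim: C => /= [|C IH|C IH t|t C IH|C IH t|t C IH]; lia. Qed.

Lemma size_plugL L s s' :
  term_size (plugL L s) + term_size s' = term_size (plugL L s') + term_size s.
Proof. by elim: L => /= [|u L IH]; lia. Qed.

Lemma size_alpha_subterm m v t : alpha_subterm m v t -> term_size v <= term_size t.
Proof.
case=> C [s [rho [<- <- _ _ _]]]; rewrite size_rename.
exact: leq_trans (leq_addl _ _) (size_path_plug C s).
Qed.

(** dB trades an application and an abstraction for one explicit substitution, losing a constructor;
    ls replaces a variable, of size 1, by the copy. *)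
Lemma size_target r M :
  (forall m v, duplicated r = Some (m, v) -> term_size v <= M) ->
  term_size (target r) <= term_size (source r) + M.
Proof.
case: r => [E L t u|E C u] /= hM.
  have := size_plug E (App (plugL L (Lam t)) u) (plugL L (ESub t (shift (size L) u))).
  have := size_plugL L (Lam t) (ESub t (shift (size L) u)).
  by rewrite /= size_rename; lia.
have := size_plug E (ESub (plug C (Var (depth C))) u)
  (ESub (plug C (shift (depth C).+1 u)) u).
have := size_plug C (Var (depth C)) (shift (depth C).+1 u).
by have := hM _ _ erefl; rewrite /= size_rename; lia.
Qed.

Lemma size_derivation X t rs u M : derivation X t rs u ->
  (forall r m v, List.In r rs -> duplicated r = Some (m, v) -> term_size v <= M) ->
  term_size u <= term_size t + size rs * M.
Proof.
elim=> {t rs u} [t _|t r rs u Xt _ IH hM]; first by rewrite addn0.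
have [_ <-] := selectP Xt.
have := @size_target r M (fun m v => hM r m v (or_introl erefl)).
have := IH (fun r' m v h => hM r' m v (or_intror h)).
by rewrite /= mulSn; lia.
Qed.

Lemma size_reduct X k t : subterm_property X ->
  term_size (reduct X k t) <= k.+1 * term_size t.
Proof.
move=> hX; have [rs rsP hk] := reductP X k t.
have rk : size rs <= k by case: hk => [->//|[/ltnW]].
apply: leq_trans (size_derivation (M := term_size t) rsP _) _; last first.
  by rewrite mulSn leq_add2l leq_mul2r rk orbT.
by move=> r m v hr /(hX _ _ _ rsP _ _ _ hr)/size_alpha_subterm.
Qed.

(** * Polynomial bounds *)

(** Coefficients are natural numbers, so each Horner step is monotone. *)
Lemma leq_horner (p : {poly nat}) x y : x <= y -> p.[x]%R <= p.[y]%R.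
Proof.
move=> xy; elim/poly_ind: p => [|p c IH]; first by rewrite !horner0.
rewrite !hornerMXaddC; exact: leq_add (leq_mul IH xy) (leqnn c).
Qed.

(** The outer indeterminate stands for [k] and the coefficients are polynomials in [n]. Closure
    properties spare writing the final polynomial explicitly. *)
Definition poly_bounded (f : nat -> nat -> nat) : Prop :=
  exists p : {poly {poly nat}}, forall k n, f k n <= (p.[k%:P].[n])%R.

Lemma poly_bounded_const c : poly_bounded (fun _ _ => c).
Proof. by exists (c%:P%:P)%R => k n; rewrite !hornerC. Qed.

Lemma poly_bounded_fst : poly_bounded (fun k _ => k).
Proof. by exists 'X%R => k n; rewrite hornerX hornerC. Qed.

Lemma poly_bounded_snd : poly_bounded (fun _ n => n).
Proof. by exists ('X%:P)%R => k n; rewrite hornerC hornerX. Qed.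

Lemma poly_boundedD f g : poly_bounded f -> poly_bounded g ->
  poly_bounded (fun k n => f k n + g k n).
Proof.
move=> [p fp] [q gq]; exists (p + q)%R => k n.
by rewrite !hornerD; exact: leq_add.
Qed.

Lemma poly_boundedM f g : poly_bounded f -> poly_bounded g ->
  poly_bounded (fun k n => f k n * g k n).
Proof.
move=> [p fp] [q gq]; exists (p * q)%R => k n.
by rewrite !hornerM; exact: leq_mul.
Qed.

Lemma poly_bounded_horner (p : {poly nat}) f : poly_bounded f ->
  poly_bounded (fun k n => p.[f k n]%R).
Proof.
move=> hf; elim/poly_ind: p => [|p c IH].
  by have [q hq] := poly_bounded_const 0; exists q => k n; rewrite horner0.
have [q hq] := poly_boundedD (poly_boundedM IH hf) (poly_bounded_const c).
by exists q => k n; rewrite hornerMXaddC; exact: hq.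
Qed.

(** * The machine *)

(** Registers 0 to 8 belong to the machine, so [c] runs from 9 on. On a normal form the search
    answers [Leaf]: the term stays while [rK] still decreases, as in [onestep]. *)
Definition iteration (c : cmd) : cmd :=
  Seq (call 9 c rT rP) (Seq (If (EVar rP) fire Skip) (pop rK)).

Definition machine (c : cmd) : cmd :=
  Seq (Seq (Assign rK (ETl (EVar rT))) (Assign rT (EHd (EVar rT))))
    (While (EVar rK) (iteration c)).

Definition computes_selection (X : strategy) (c : cmd) (p : {poly nat}) : Prop :=
  forall u, exists2 n,
    computes c (enc_term u) (enc_option enc_position (omap position (X u))) n &
    n <= p.[term_size u]%R.

Definition iteration_bound (c : cmd) (p : {poly nat}) (x : nat) : nat :=
  p.[x]%R + 4 * cmd_bound c + fire_bound x + 30.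

Lemma leq_iteration_bound c p x y : x <= y ->
  iteration_bound c p x <= iteration_bound c p y.
Proof.
move=> xy; rewrite /iteration_bound !leq_add2r leq_add ?leq_add2r ?leq_horner //.
by rewrite leq_mul2l leq_mul.
Qed.

Lemma execb_iteration X c p u K l r : computes_selection X c p -> size l = 7 ->
  exists l' r', size l' = 7 /\
  execb (iteration c) (store_of [:: enc_term u, Node Leaf K & l] r)
    (iteration_bound c p (term_size u))
    (store_of [:: enc_term (onestep X u), K & l'] r').
Proof.
move=> sel; case: l => [|l2 [|l3 [|l4 [|l5 [|l6 [|l7 [|l8 [|]]]]]]]] // _.
have [n cn np] := sel u.
set L := [:: enc_term u, _ & _].
have [r' h1] := @execb_call c rT rP L r _ _ n cn isT isT erefl.
rewrite /L /= in h1; rewrite /onestep.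
case Xu: (X u) h1 => [rd|] h1.
  have [_ ru] := selectP Xu.
  have [l sl h2] := execb_fire rd (Node Leaf K) l3 l4 l5 l6 l7 l8 r'.
  rewrite ru in h2.
  case: l sl h2 => [|m2 [|m3 [|m4 [|m5 [|m6 [|m7 [|m8 [|]]]]]]]] // _ h2.
  exists [:: m2; m3; m4; m5; m6; m7; m8], r'; split=> //.
  apply: execb_le.
    apply: execb_seq h1 _; apply: execb_seq.
      by apply: execb_if_true => //; exact: h2.
    by apply: (@execb_straight_le 3).
  by rewrite /iteration_bound /=; lia.
exists [:: Leaf; l3; l4; l5; l6; l7; l8], r'; split=> //.
apply: execb_le.
  apply: execb_seq h1 _; apply: execb_seq.
    by apply: execb_if_false => //; exact: execb_straight.
  by apply: (@execb_straight_le 3).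
by rewrite /iteration_bound /=; lia.
Qed.

(** Only the reducts before the [k]-th are searched, so only their sizes matter. Each [+ 2] pays a
    loop test. *)
Lemma execb_iterations X c p k u l r x : computes_selection X c p -> size l = 7 ->
  (forall i, i < k -> term_size (reduct X i u) <= x) ->
  exists l' r',
  execb (While (EVar rK) (iteration c)) (store_of [:: enc_term u, enc_nat k & l] r)
    (k * (iteration_bound c p x + 2) + 2)
    (store_of [:: enc_term (reduct X k u), Leaf & l'] r').
Proof.
move=> sel; elim: k u l r => [|k IH] u l r sl hx.
  exists l, r; exists 2 => //; exact: exec_while_false.
have [l1 [r1 [sl1 [n1 h1 b1]]]] := execb_iteration u (enc_nat k) r sel sl.
have [|l2 [r2 [n2 h2 b2]]] := IH (onestep X u) l1 r1 sl1.
  by move=> i ik; have := hx i.+1 ik; rewrite /reduct iterSr.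
exists l2, r2; rewrite /reduct iterSr; exists (1 + n1 + n2).+1.
  exact: (@exec_while_true (EVar rK)) h1 h2.
have := leq_iteration_bound c p (hx 0 isT); rewrite [reduct _ _ _]/= => b3.
by rewrite mulSn; lia.
Qed.

Lemma computes_machine X c p t k x : computes_selection X c p ->
  (forall i, i < k -> term_size (reduct X i t) <= x) ->
  exists2 n, computes (machine c) (Node (enc_term t) (enc_nat k))
    (enc_term (reduct X k t)) n &
  n <= k * (iteration_bound c p x + 2) + 12.
Proof.
move=> sel hx; pose z := nseq 7 Leaf.
have [l [r h]] := @execb_iterations X c p k t z (fun=> Leaf) x sel erefl hx.
(* Unset variables are [Leaf], so the nine registers can be listed without changing the store. *)
have s0 : upd (fun=> Leaf) 0 (Node (enc_term t) (enc_nat k)) =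
    store_of [:: Node (enc_term t) (enc_nat k), Leaf & z] (fun=> Leaf).
  by apply: functional_extensionality; do 9 case=> //.
have h0 : execb (Seq (Assign rK (ETl (EVar rT))) (Assign rT (EHd (EVar rT))))
    (upd (fun=> Leaf) 0 (Node (enc_term t) (enc_nat k))) 8
    (store_of [:: enc_term t, enc_nat k & z] (fun=> Leaf)).
  by rewrite s0; exact: execb_straight_le.
have [n hn bn] := execb_seq h0 h.
by exists n; [eexists; [exact: hn|] | lia].
Qed.

(* p ranges over the polynomials in two variables, evaluated at k and |t|. *)
Theorem mainTheorem4 (X : strategy) (hX : mechanisable X) :
  exists (c : cmd) (p : {poly {poly nat}}),
  forall (t : term) (k : nat),
  exists2 n : nat,
    computes c (Node (enc_term t) (enc_nat k)) (enc_term (reduct X k t)) n &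
    n <= (p.[k%:P].[term_size t])%R.
Proof.
have [subX [c [p sel]]] := hX.
(* Every term is reached from itself by the empty derivation. *)
have sel' : computes_selection X c p by move=> u; exact: sel (deriv_refl X u).
pose x k n := k.+1 * n.
pose f k n := k * (iteration_bound c p (x k n) + 2) + 12.
have [q hq] : poly_bounded f.
  have bx : poly_bounded x.
    by apply: (poly_boundedM (poly_boundedD (poly_bounded_const 1) poly_bounded_fst));
      exact: poly_bounded_snd.
  (* By conversion [1 + x] is the [x.+1] of [fire_bound]. *)
  have bx1 := poly_boundedD (poly_bounded_const 1) bx.
  apply: (poly_boundedD _ (poly_bounded_const _)).
  apply: (poly_boundedM poly_bounded_fst).
  apply: (poly_boundedD _ (poly_bounded_const _)).
  apply: (poly_boundedD _ (poly_bounded_const _)).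
  apply: (poly_boundedD (poly_boundedD (poly_bounded_horner _ bx) (poly_bounded_const _))).
  exact: poly_boundedM (poly_bounded_const _) (poly_boundedM bx1 bx1).
exists (machine c), q => t k.
have [i ik|n hn bn] := @computes_machine X c p t k (x k (term_size t)) sel'.
  by apply: leq_trans (size_reduct _ _ subX) _; rewrite /x leq_mul2r; lia.
by exists n => //; apply: leq_trans bn (hq k _).
Qed.
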